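(* Let $B_{80,4}$ be the binary code of length $80$ with generator matrix $$\left(\begin{array}{c|cccc} & 0 & 1 & \cdots & 1\\ & 1 & & & \\ I_{40} & \vdots & & R & \\ & 1 & & & \end{array}\right),$$ where $I_{40}$ is the identity matrix of order $40$ and $R$ is the $39\times 39$ circulant matrix with first row $$(111100000100101111101011101001101100011).$$ Let $x_{80}\in\mathbb{F}_2^{80}$ be the vector with support $$\{ 2, 5, 8, 11, 14, 17, 20, 23, 26, 29, 32, 35, 38\}.$$ Then the code $C_{82}=B_{80,4}(x_{80})$ is a singly even self-dual $[82,41,14]$ code with minimal shadow.
   Context: All codes are binary: a code of length $n$ is a subspace of $\mathbb{F}_2^n$, and $[n,k,d]$ denotes length $n$, dimension $k$, minimum weight $d$. Coordinates are numbered $1,\dots,n$. A code $C$ is self-dual if $C=C^\perp$ with respect to the standard inner product. A self-dual code is doubly even if all codeword weights are $\equiv 0 \pmod 4$, and singly even if it contains a codeword of weight $\equiv 2 \pmod 4$. A circulant matrix is one in which each row is the cyclic shift of the previous row by one position to the right. The code $B_{80,4}$ is a known extremal doubly even self-dual $[80,40,16]$ code. Construction of $C(x)$: let $C$ be a doubly even self-dual code of length $8t$ and $x\in\mathbb{F}_2^{8t}$ a vector of odd weight. Let $C^0$ be the subcode of $C$ consisting of all codewords orthogonal to $x$. There are cosets $C^1,C^2,C^3$ of $C^0$ such that $(C^0)^\perp = C^0\cup C^1\cup C^2\cup C^3$, where $C=C^0\cup C^2$ and $x+C=C^1\cup C^3$. Then $$C(x)= (0,0,C^0) \cup (1,1,C^2)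 \cup (1,0,C^1) \cup (0,1,C^3)\subseteq\mathbb{F}_2^{8t+2},$$ where $(a,b,C^i)=\{(a,b,c)\mid c\in C^i\}$. (Interchanging the names $C^1$ and $C^3$ only interchanges the first two coordinates of $C(x)$.) For a singly even self-dual code $D$, let $D_0$ be the subcode of codewords of weight $\equiv 0\pmod 4$; the shadow of $D$ is $D_0^\perp\setminus D$. A singly even self-dual code of length $n$ is said to have minimal shadow if the minimum weight of its shadow is $4,1,2,3$ when $n\equiv 0,2,4,6 \pmod 8$, respectively (so for length $82$ the shadow has minimum weight $1$). *)

(* Defs.v *)
From HB Require Import structures.
From mathcomp Require Import all_boot all_order all_algebra.

Set Implicit Arguments.
Unset Strict Implicit.
Unset Printing Implicit Defensive.

Import GRing.Theory.
Local Open Scope ring_scope.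

(* A binary code of length n is a subspace C : {vspace 'rV['F_2]_n}.  Objects
   that are not, or not yet known to be, subspaces (cosets, shadows, duals,
   the union C(x)) are finite sets of type {set 'rV['F_2]_n}.  *)

Definition wt n (v : 'rV['F_2]_n) : nat := #|[set i | v 0 i != 0]|.

Definition dot n (u v : 'rV['F_2]_n) : 'F_2 := \sum_i u 0 i * v 0 i.

Definition dual n (S : {pred 'rV['F_2]_n}) : {set 'rV['F_2]_n} :=
  [set v | [forall c in S, dot v c == 0]].

Definition self_dual n (C : {vspace 'rV['F_2]_n}) : Prop := C =i dual (mem C).

Definition doubly_even n (C : {vspace 'rV['F_2]_n}) : Prop :=
  forall c, c \in C -> (4 %| wt c)%N.

Definition singly_even n (C : {vspace 'rV['F_2]_n}) : Prop :=
  exists2 c, c \in C & wt c = 2 %[mod 4].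

(* d is attained by, and is a lower bound for, the weights of the nonzero
   vectors of S.  *)
Definition min_weight n (S : {pred 'rV['F_2]_n}) (d : nat) : Prop :=
  (exists c, [/\ c \in S, c != 0 & wt c = d]) /\
  (forall c, c \in S -> c != 0 -> (d <= wt c)%N).

(* C is an [n, k, d] code.  *)
Definition code_params n (C : {vspace 'rV['F_2]_n}) (k d : nat) : Prop :=
  \dim C = k /\ min_weight (mem C) d.

Definition doubly_even_subcode n (C : {vspace 'rV['F_2]_n}) :
    {set 'rV['F_2]_n} :=
  [set c in C | 4 %| wt c]%N.

Definition shadow n (C : {vspace 'rV['F_2]_n}) : {set 'rV['F_2]_n} :=
  dual (mem (doubly_even_subcode C)) :\: [set c in C].

(* Only meant for singly even self-dual C, so that n is even; the last branch
   is never relevant.  *)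
Definition minimal_shadow n (C : {vspace 'rV['F_2]_n}) : Prop :=
  match (n %% 8)%N with
  | 0 => min_weight (mem (shadow C)) 4
  | 2 => min_weight (mem (shadow C)) 1
  | 4 => min_weight (mem (shadow C)) 2
  | 6 => min_weight (mem (shadow C)) 3
  | _ => False
  end.

Definition translate n (v : 'rV['F_2]_n) (S : {pred 'rV['F_2]_n}) :
    {set 'rV['F_2]_n} :=
  [set v + c | c in S].

Definition is_coset n (S A : {set 'rV['F_2]_n}) : Prop :=
  exists v, A = translate v (mem S).

Definition prefix2 n (a b : 'F_2) (c : 'rV['F_2]_n) : 'rV['F_2]_n.+2 :=
  row_mx (n1 := 1) (n2 := 1 + n) (const_mx a)
    (row_mx (n1 := 1) (n2 := n) (const_mx b) c).

Definition orth_subcode n (C : {vspace 'rV['F_2]_n}) (x : 'rV['F_2]_n) :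
    {set 'rV['F_2]_n} :=
  [set c in C | dot c x == 0].

(* S is C(x) for one of the two admissible labellings of the cosets C1 and C3
   (the two choices differ by swapping the first two coordinates of S).  The
   standing hypotheses on C and x are part of the predicate; they force the
   length n to be divisible by 8.  *)
Definition is_code_ext n (C : {vspace 'rV['F_2]_n}) (x : 'rV['F_2]_n)
    (S : {set 'rV['F_2]_n.+2}) : Prop :=
  [/\ self_dual C, doubly_even C, odd (wt x) &
    let C0 := orth_subcode C x in
    exists C1 C2 C3 : {set 'rV['F_2]_n},
      [/\ [/\ is_coset C0 C1, is_coset C0 C2 & is_coset C0 C3],
          dual (mem C0) = C0 :|: C1 :|: C2 :|: C3,
          [set c in C] = C0 :|: C2,
          translate x (mem C) = C1 :|: C3 &
          S = [set prefix2 0 0 c | c in C0] :|: [set prefix2 1 1 c | c in C2]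
              :|: [set prefix2 1 0 c | c in C1]
              :|: [set prefix2 0 1 c | c in C3]]].

Definition code_of_gen k n (G : 'M['F_2]_(k, n)) : {vspace 'rV['F_2]_n} :=
  <<[seq row i G | i <- enum 'I_k]>>%VS.

(* The subtraction is that of Z/(n+1), so each row is the right cyclic shift
   of the previous one, starting from r.  *)
Definition circulant n (r : 'rV['F_2]_n.+1) : 'M['F_2]_n.+1 :=
  \matrix_(i, j) r 0 (j - i).

Definition R39_row : 'rV['F_2]_39 :=
  \row_(j < 39) nth 0
    [:: 1; 1; 1; 1; 0; 0; 0; 0; 0; 1; 0; 0; 1; 0; 1; 1; 1; 1; 1; 0;
        1; 0; 1; 1; 1; 0; 1; 0; 0; 1; 1; 0; 1; 1; 0; 0; 0; 1; 1] j.

Definition gen_B80_4 : 'M['F_2]_(40, 80) :=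
  row_mx (n1 := 40) (n2 := 40) 1%:M
    (block_mx (m1 := 1) (m2 := 39) (n1 := 1) (n2 := 39)
       (const_mx 0) (const_mx 1)
       (const_mx 1) (circulant R39_row)).

Definition B80_4 : {vspace 'rV['F_2]_80} := code_of_gen gen_B80_4.

(* Coordinates of the support are numbered from 1.  *)
Definition x80 : 'rV['F_2]_80 :=
  \row_(j < 80)
    (j.+1 \in [:: 2; 5; 8; 11; 14; 17; 20; 23; 26; 29; 32; 35; 38]%N)%:R.

(* Main.v *)
(* Over F_2 both labellings of the cosets give
     C(x) = {(a, b, c) | c + (a + b) x \in C and c . x = a + t (a + b)}
   for some t in F_2.  From this description self-duality, the dimension and
   the weights modulo 4 are direct; a unit vector in one of the first two
   coordinates lies in the shadow.  The minimum weight is 14 as soon as C has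
   no word of weight 4, 8 or 12 and x + C no word of weight at most 11.
   C is generated by [I | A] with A A^T = I, so its words are (y, y A), and
   also (q A^T, q).  A word of C or of x + C of small weight has small weight on
   one of its halves, and that half determines the word: an exhaustive search
   over at most 6 rows of A, or at most 5 rows of A^T, excludes it. *)
From Corelib Require Import BinNums.
Require Import Defs.
From mathcomp Require Import all_boot all_order all_algebra zify.

Set Implicit Arguments.
Unset Strict Implicit.
Unset Printing Implicit Defensive.

Import GRing.Theory.
Local Open Scope ring_scope.

(** * Arithmetic in F_2, weights and inner products *)

Variant F2_spec : 'F_2 -> Type := F2_0 : F2_spec 0 | F2_1 : F2_spec 1.

Lemma F2P (a : 'F_2) : F2_spec a.
Proof.
case: a => [[|[|m]] ltm] //.
- by rewrite (_ : Ordinal _ = 0); [constructor | apply: val_inj].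
- by rewrite (_ : Ordinal _ = 1); [constructor | apply: val_inj].
Qed.

Lemma F2_cases (a : 'F_2) : {a = 0} + {a = 1}.
Proof. by case: (F2P a); [left | right]. Qed.

Lemma F2_addxx (a : 'F_2) : a + a = 0.
Proof. by case: (F2P a); apply: val_inj. Qed.

Lemma natrF2 (m : nat) : m%:R = (odd m)%:R :> 'F_2.
Proof.
by elim: m => //= m IHm; rewrite mulrS IHm; case: (odd m); apply: val_inj.
Qed.

Lemma natrF2_eq0 (m : nat) : (m%:R == 0 :> 'F_2) = ~~ odd m.
Proof. by rewrite natrF2; case: (odd m). Qed.

Section Vectors.
Variable n : nat.
Implicit Types u v w c x : 'rV['F_2]_n.

Definition overlap u v : nat :=
  (\sum_(i < n) ((u 0%R i != 0%R) && (v 0%R i != 0%R)))%N.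

Lemma wtE v : wt v = (\sum_(i < n) (v 0%R i != 0%R))%N.
Proof. by rewrite /wt cardsE -sum1_card big_mkcond. Qed.

Lemma wt0 : wt (0 : 'rV['F_2]_n) = 0%N.
Proof. by rewrite wtE big1 // => i _; rewrite mxE eqxx. Qed.

Lemma wt_eq0 v : (wt v == 0)%N = (v == 0).
Proof.
apply/idP/eqP => [|->]; last by rewrite wt0.
rewrite wtE sum_nat_eq0 => /forallP v0; apply/rowP => i; rewrite mxE.
by have := v0 i; rewrite eqb0 negbK => /eqP.
Qed.

Lemma wt_gt0 v : (0 < wt v)%N = (v != 0).
Proof. by rewrite lt0n wt_eq0. Qed.

Lemma wtD u v : (wt (u + v) + (overlap u v).*2 = wt u + wt v)%N.
Proof.
rewrite !wtE -mul2n big_distrr -!big_split /=; apply: eq_bigr => i _.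
by rewrite mxE; case: (F2P (u 0 i)); case: (F2P (v 0 i)).
Qed.

Lemma dotE u v : dot u v = (overlap u v)%:R.
Proof.
rewrite /dot /overlap natr_sum; apply: eq_bigr => i _.
by case: (F2P (u 0 i)); case: (F2P (v 0 i)); rewrite ?mulr0 ?mul0r ?mulr1.
Qed.

Lemma dot_mx u v : dot u v = (u *m v^T) 0 0.
Proof. by rewrite mxE; apply: eq_bigr => i _; rewrite mxE. Qed.

Lemma dotC u v : dot u v = dot v u.
Proof. by apply: eq_bigr => i _; rewrite mulrC. Qed.

Lemma dotDl u v w : dot (u + v) w = dot u w + dot v w.
Proof. by rewrite !dot_mx mulmxDl mxE. Qed.

Lemma dotDr u v w : dot u (v + w) = dot u v + dot u w.
Proof. by rewrite dotC dotDl !(dotC u). Qed.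

Lemma dotZl a u v : dot (a *: u) v = a * dot u v.
Proof. by rewrite !dot_mx -scalemxAl mxE. Qed.

Lemma dotZr a u v : dot u (a *: v) = a * dot u v.
Proof. by rewrite dotC dotZl dotC. Qed.

Lemma dot0l u : dot 0 u = 0.
Proof. by rewrite dot_mx mul0mx mxE. Qed.

Lemma dotvv v : dot v v = (wt v)%:R.
Proof.
rewrite dotE wtE; congr (_%:R); apply: eq_bigr => i _.
by rewrite andbb.
Qed.

Lemma F2_addvv v : v + v = 0.
Proof. by apply/rowP => i; rewrite !mxE F2_addxx. Qed.

Lemma dualP (S : {pred 'rV['F_2]_n}) v :
  reflect (forall c, c \in S -> dot v c = 0) (v \in dual S).
Proof.
rewrite inE; apply: (iffP forallP) => [h c Sc|h c].
  by have /implyP/(_ Sc)/eqP := h c.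
by apply/implyP => /h ->.
Qed.

(** Orthogonality makes the overlap even, so its double vanishes modulo 4. *)
Lemma wtD_mod4 u v : dot u v = 0 -> wt (u + v) = wt u + wt v %[mod 4].
Proof.
move/eqP; rewrite dotE natrF2_eq0 => ev; rewrite -(wtD u v).
rewrite -(even_halfK ev); lia.
Qed.

(** Over F_2 the only scalars are 0 and 1, so additive closure suffices. *)
Lemma vspace_of_add_closed (S : {set 'rV['F_2]_n}) :
  0 \in S -> (forall u v, u \in S -> v \in S -> u + v \in S) ->
  <<enum S>>%VS =i S.
Proof.
move=> S0 SD v; apply/idP/idP => [/coord_span ->|Sv]; last first.
  by apply: memv_span; rewrite mem_enum.
elim/big_ind: _ => // i _.
case: (F2P (coord _ i v)); rewrite ?scale0r ?scale1r //.
by rewrite -mem_enum; apply: mem_nth; rewrite size_tuple.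
Qed.

End Vectors.

(** * Vectors with two prefixed coordinates *)

Section Prefix.
Variable n : nat.
Implicit Types (a b : 'F_2) (c d : 'rV['F_2]_n) (u v : 'rV['F_2]_n.+2).

Lemma prefix2_0 a b c : prefix2 a b c 0 ord0 = a.
Proof. by rewrite mxE; case: splitP => // j _; rewrite mxE. Qed.

Lemma prefix2_1 a b c : prefix2 a b c 0 (lift ord0 ord0) = b.
Proof.
rewrite mxE; case: splitP => [[[]]|j] //= [j0].
by rewrite mxE; case: splitP => k jk; rewrite ?mxE //; lia.
Qed.

Lemma prefix2_2 a b c i : prefix2 a b c 0 (lift ord0 (lift ord0 i)) = c 0 i.
Proof.
rewrite mxE; case: splitP => [[[]]|j] //= [ji].
rewrite mxE; case: splitP => k jk.
  by move: ji jk; case: k => -[] // ? /=; rewrite /bump; lia.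
by congr (c _ _); apply: val_inj => /=; move: ji jk; rewrite /= /bump; lia.
Qed.

Definition prefix2E := (prefix2_0, prefix2_1, prefix2_2).

Lemma rV2P u v : u 0 ord0 = v 0 ord0 ->
    u 0 (lift ord0 ord0) = v 0 (lift ord0 ord0) ->
    (forall i, u 0 (lift ord0 (lift ord0 i)) = v 0 (lift ord0 (lift ord0 i))) ->
  u = v.
Proof.
move=> e0 e1 e2; apply/rowP => i.
case: (unliftP ord0 i) => [j|] -> //.
by case: (unliftP ord0 j) => [k|] ->.
Qed.

Lemma prefix2P v : exists a b c, v = prefix2 a b c.
Proof.
exists (v 0 ord0), (v 0 (lift ord0 ord0)).
exists (\row_i v 0 (lift ord0 (lift ord0 i))).
by apply: rV2P => [||i]; rewrite prefix2E ?mxE.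
Qed.

Lemma prefix2_inj a b c a' b' c' :
  prefix2 a b c = prefix2 a' b' c' -> [/\ a = a', b = b' & c = c'].
Proof.
move=> /rowP e; split.
- by have := e ord0; rewrite !prefix2E.
- by have := e (lift ord0 ord0); rewrite !prefix2E.
- by apply/rowP => i; have := e (lift ord0 (lift ord0 i)); rewrite !prefix2E.
Qed.

Lemma prefix2D a b c a' b' c' :
  prefix2 a b c + prefix2 a' b' c' = prefix2 (a + a') (b + b') (c + c').
Proof.
by apply: rV2P => [||i]; rewrite [LHS]mxE !prefix2E ?mxE.
Qed.

Lemma prefix2Z k a b c : k *: prefix2 a b c = prefix2 (k * a) (k * b) (k *: c).
Proof.
by apply: rV2P => [||i]; rewrite [LHS]mxE !prefix2E ?mxE.
Qed.

Lemma prefix2_eq0 : prefix2 0 0 0 = 0 :> 'rV['F_2]_n.+2.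
Proof. by apply: rV2P => [||i]; rewrite [RHS]mxE prefix2E ?mxE. Qed.

Lemma wt_prefix2 a b c :
  wt (prefix2 a b c) = ((a != 0%R) + ((b != 0%R) + wt c))%N.
Proof.
rewrite !wtE !big_ord_recl !prefix2E; congr (_ + (_ + _))%N.
by apply: eq_bigr => i _; rewrite prefix2E.
Qed.

Lemma dot_prefix2 a b c a' b' c' :
  dot (prefix2 a b c) (prefix2 a' b' c') = a * a' + (b * b' + dot c c').
Proof.
rewrite /dot !big_ord_recl !prefix2E; congr (_ + (_ + _)).
by apply: eq_bigr => i _; rewrite !prefix2E.
Qed.

Lemma mul_prefix2 a b c (x : 'rV['F_2]_n) :
  prefix2 a b c *m (col_mx x (col_mx x 1%:M) : 'M_(1 + (1 + n), n)) =
  c + (a + b) *: x.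
Proof.
have const_mul k : (const_mx k : 'M['F_2]_1) *m x = k *: x.
  by apply/rowP => i; rewrite !mxE big_ord1 mxE.
pose u := row_mx (const_mx a : 'M_1) (row_mx (const_mx b : 'M_1) c).
transitivity (u *m col_mx x (col_mx x 1%:M)); first by [].
rewrite !mul_row_col mulmx1 !const_mul.
by rewrite scalerDl addrA addrC.
Qed.

End Prefix.

Lemma dual_vspaceP n (D : {vspace 'rV['F_2]_n}) v :
  reflect (forall c, c \in D -> dot v c = 0) (v \in dual (mem D)).
Proof. by apply: (iffP (dualP _ _)) => h c; apply: h. Qed.

(** * The code C(x) *)

Section Extension.
Variables (n : nat) (C : {vspace 'rV['F_2]_n}) (x : 'rV['F_2]_n).
Hypotheses (selfC : self_dual C) (x_odd : odd (wt x)).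
Implicit Types (c v : 'rV['F_2]_n) (S : {set 'rV['F_2]_n.+2}).

Lemma self_dualP v : reflect (forall c, c \in C -> dot v c = 0) (v \in C).
Proof. by rewrite selfC; apply: dual_vspaceP. Qed.

Lemma self_dual_dot c v : c \in C -> v \in C -> dot c v = 0.
Proof. by move=> /self_dualP; apply. Qed.

Lemma dot_self_odd : dot x x = 1.
Proof. by rewrite dotvv natrF2 x_odd. Qed.

Lemma odd_notin : x \notin C.
Proof.
by apply/negP => xC; have := self_dual_dot xC xC; rewrite dot_self_odd.
Qed.

(** Otherwise [x] would lie in the dual of [C], which is [C]; a vector of odd weight does not. *)
Lemma exists_nonorth : exists2 c, c \in C & dot c x = 1.
Proof.
have: ~~ [forall c in C, dot x c == 0].
  apply: contra odd_notin => /forallP h; apply/self_dualP => c cC.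
  by have /implyP/(_ cC)/eqP := h c.
case/forallPn => c; rewrite negb_imply dotC => /andP[cC cx0].
by exists c => //; move: cx0; case: (F2P (dot c x)).
Qed.

(* The parameter [t] selects one of the two labellings of the cosets [C1] and
   [C3]: [t = 0] is [C1 = x + C0]. *)
Definition ext_spec (t : 'F_2) S := forall a b c,
  (prefix2 a b c \in S) =
  (c + (a + b) *: x \in C) && (dot c x == a + t * (a + b)).

(** On [C] the functional [dot v] vanishes on the kernel of [dot x], so it is either zero or
    [dot x]; self-duality then puts [v] or [v + x] in [C]. *)
Lemma dual_orth_subcode v :
  (v \in dual (mem (orth_subcode C x))) = (v \in C) || (v + x \in C).
Proof.
have [c2 c2C c2x] := exists_nonorth.
apply/dualP/orP => [h|vC c]; last first.
  rewrite inE => /andP[cC /eqP cx]; case: vC => vC.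
    exact: self_dual_dot.
  by have := self_dual_dot vC cC; rewrite dotDl (dotC x) cx addr0.
have split_c c : c \in C -> dot v c = dot c x * dot v c2.
  move=> cC; case: (F2_cases (dot c x)) => cx.
    by rewrite cx mul0r h // inE cC cx /=.
  (* Both [c] and [c2] have product 1 with [x], so their sum lies in C0. *)
  have: dot v (c + c2) = 0.
    by apply: h; rewrite inE rpredD //= dotDl cx c2x; apply/eqP; apply: val_inj.
  by rewrite dotDr cx mul1r; case: (F2P (dot v c)); case: (F2P (dot v c2)).
case: (F2_cases (dot v c2)) => vc2.
  by left; apply/self_dualP => c /split_c ->; rewrite vc2 mulr0.
right; apply/self_dualP => c cC; rewrite dotDl (dotC x) split_c // vc2 mulr1.
by case: (F2P (dot c x)); apply: val_inj.
Qed.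

Lemma translateE v (A : {pred 'rV['F_2]_n}) c :
  (c \in translate v A) = (c + v \in A).
Proof.
apply/imsetP/idP => [[d dA ->]|cvA]; first by rewrite addrAC F2_addvv add0r.
by exists (c + v) => //; rewrite addrCA F2_addvv addr0.
Qed.

Lemma mem_coset v c :
  (c \in translate v (mem (orth_subcode C x))) =
  (c + v \in C) && (dot c x == dot v x).
Proof.
rewrite translateE inE dotDl; congr (_ && _).
by case: (F2P (dot c x)); case: (F2P (dot v x)).
Qed.

Lemma mem_prefix2_imset (A : {set 'rV['F_2]_n}) a b a' b' c :
  (prefix2 a b c \in [set prefix2 a' b' d | d in A]) =
  [&& a == a', b == b' & c \in A].
Proof.
apply/imsetP/and3P => [[d dA /prefix2_inj[-> -> ->]] //|[/eqP-> /eqP-> cA]].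
by exists c.
Qed.

(** The unions giving [C] and [x + C] fix the cosets up to one bit: [v2] is in [C] and not
    orthogonal to [x], while [v1] and [v3] are in [x + C] and have different products with [x]. *)
Lemma code_ext_spec S : is_code_ext C x S -> exists t, ext_spec t S.
Proof.
case=> _ _ _ [C1 [C2 [C3 [[[v1 ->] [v2 ->] [v3 ->]] _ defC defxC ->]]]].
have [c2 c2C c2x] := exists_nonorth.
have memC c : (c \in C) =
    (c \in orth_subcode C x) || (c \in translate v2 (mem (orth_subcode C x))).
  by have /setP/(_ c) := defC; rewrite in_setU inE.
have memxC c : (c + x \in C) = (c + v1 \in C) && (dot c x == dot v1 x)
    || (c + v3 \in C) && (dot c x == dot v3 x).
  by have /setP/(_ c) := defxC; rewrite in_setU !mem_coset translateE.
have v2C : v2 \in C by rewrite memC mem_coset F2_addvv mem0v eqxx orbT.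
have v1C : v1 + x \in C by rewrite memxC F2_addvv mem0v eqxx.
have v3C : v3 + x \in C by rewrite memxC F2_addvv mem0v eqxx orbT.
have add_mem u c : u \in C -> (c + u \in C) = (c \in C).
  by move=> uC; rewrite rpredDr.
have v2x : dot v2 x = 1.
  by have := c2C; rewrite memC mem_coset inE c2x andbF /= => /andP[_ /eqP <-].
have addv c v : v + x \in C -> (c + v \in C) = (c + x \in C).
  move=> vC; rewrite -(add_mem (v + x) (c + x) vC); congr (_ \in C).
  by rewrite addrACA F2_addvv addr0.
(* [v1 + c2] is in [x + C], but its product with [x] differs from that of [v1], so it falls in
   C3. *)
have v3x : dot v3 x = dot v1 x + 1.
  have := add_mem _ (v1 + x) c2C; rewrite v1C addrAC memxC.
  rewrite (addv _ _ v1C) (addv _ _ v3C) addrAC (add_mem _ _ c2C) v1C /=.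
  rewrite dotDl c2x.
  by case: (F2P (dot v1 x)); case: (F2P (dot v3 x)) => // _; apply: val_inj.
(* On C1 the prefix is [(1, 0)], so [a + t (a + b)] is [1 + t], which must equal [dot v1 x]. *)
exists (dot v1 x + 1) => a b c.
rewrite !in_setU !mem_prefix2_imset !mem_coset inE (add_mem _ _ v2C).
rewrite (addv _ _ v1C) (addv _ _ v3C) v2x v3x.
have char2 := F2_addxx 1.
case: (F2P a); case: (F2P b);
  rewrite /= ?(orbF, addr0, add0r, char2, scale0r, scale1r, mulr0, mulr1) //.
by rewrite addrCA char2 addr0.
Qed.

Lemma code_ext_exists : doubly_even C -> exists S, is_code_ext C x S.
Proof.
move=> evC; have [c2 c2C c2x] := exists_nonorth.
pose C0 := orth_subcode C x.
pose C1 := translate x (mem C0); pose C2 := translate c2 (mem C0).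
pose C3 := translate (x + c2) (mem C0).
exists ([set prefix2 0 0 c | c in C0] :|: [set prefix2 1 1 c | c in C2]
  :|: [set prefix2 1 0 c | c in C1] :|: [set prefix2 0 1 c | c in C3]).
split=> //; exists C1, C2, C3.
have inC2 c : (c \in C2) = (c \in C) && (dot c x == 1).
  by rewrite mem_coset c2x rpredDr.
have inC1 c : (c \in C1) = (c + x \in C) && (dot c x == 1).
  by rewrite mem_coset dot_self_odd.
have inC3 c : (c \in C3) = (c + x \in C) && (dot c x == 0).
  by rewrite mem_coset dotDl dot_self_odd c2x addrA rpredDr.
have defC c : (c \in C) = (c \in C0) || (c \in C2).
  by rewrite inC2 inE -andb_orr; case: (F2P (dot c x)); rewrite ?andbT.
have defxC c : (c + x \in C) = (c \in C1) || (c \in C3).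
  by rewrite inC1 inC3 -andb_orr; case: (F2P (dot c x)); rewrite ?andbT.
split=> //.
- by split; [exists x | exists c2 | exists (x + c2)].
- apply/setP => c; rewrite dual_orth_subcode defC defxC !in_setU.
  by rewrite -!orbA; congr (_ || _); rewrite orbCA.
- by apply/setP => c; rewrite in_setU inE defC.
- by apply/setP => c; rewrite in_setU translateE defxC.
Qed.

Lemma ext_span t S : ext_spec t S -> <<enum S>>%VS =i S.
Proof.
move=> specS; apply: vspace_of_add_closed => [|u v].
  by rewrite -prefix2_eq0 specS !addr0 scale0r mulr0 ?addr0 mem0v dot0l.
have [a [b [c ->]]] := prefix2P u; have [a' [b' [c' ->]]] := prefix2P v.
rewrite prefix2D !specS => /andP[cC /eqP cx] /andP[cC' /eqP cx'].
rewrite [a + a' + _]addrACA; apply/andP; split.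
  by rewrite scalerDl addrACA rpredD.
by rewrite dotDl cx cx' [t * (a + b + _)]mulrDr [eqbRHS]addrACA.
Qed.

Section Spec.
Variables (t : 'F_2) (S : {set 'rV['F_2]_n.+2}) (D : {vspace 'rV['F_2]_n.+2}).
Hypotheses (specS : ext_spec t S) (DS : D =i S).

(** Orthogonality of two words follows by expanding the product of [c + (a + b) x] and
    [c' + (a' + b') x], both in [C]. Conversely, three kinds of test words suffice: [(1 + t, t, x)],
    [(1, 1, c2)], and [(0, 0, d)] with [d] in C0. *)
Lemma ext_self_dual : self_dual D.
Proof.
move=> v; have [a [b [c ->]]] := prefix2P v; rewrite DS specS.
apply/idP/dual_vspaceP => [/andP[cC /eqP cx] w|h].
  have [a' [b' [c' ->]]] := prefix2P w.
  rewrite DS specS dot_prefix2 => /andP[cC' /eqP cx'].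
  have := self_dual_dot cC cC'.
  rewrite dotDl !dotDr !dotZl !dotZr cx (dotC x) cx' dot_self_odd.
  move=> /eqP h; apply/eqP; move: (dot c c') h => z.
  by case: (F2P a); case: (F2P b); case: (F2P a'); case: (F2P b');
    case: (F2P t); case: (F2P z).
have [c2 c2C c2x] := exists_nonorth.
have x_t : a * (1 + t) + (b * t + dot c x) = 0.
  rewrite -dot_prefix2; apply: h; rewrite DS specS dot_self_odd.
  by rewrite -addrA F2_addxx addr0 scale1r mulr1 F2_addvv mem0v -addrA F2_addxx
    addr0 eqxx.
have c_c2 : dot c c2 = a + b.
  have: a * 1 + (b * 1 + dot c c2) = 0.
    rewrite -dot_prefix2; apply: h; rewrite DS specS c2x F2_addxx.
    by rewrite scale0r mulr0 !addr0 c2C eqxx.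
  move/eqP=> e; apply/eqP; move: e.
  by case: (F2P a); case: (F2P b); case: (F2P (dot c c2)).
apply/andP; split; last first.
  move: x_t => /eqP.
  by case: (F2P a); case: (F2P b); case: (F2P (dot c x)); case: (F2P t).
have: c \in dual (mem (orth_subcode C x)).
  apply/dualP => d; rewrite inE => /andP[dC /eqP dx].
  have := h (prefix2 0 0 d); rewrite DS specS dot_prefix2 !mulr0 !add0r; apply.
  by rewrite ?(addr0, scale0r, mulr0) dC dx eqxx.
(* [dot c c2] is 0 when [c] is in [C] and 1 when [c + x] is, so [a + b] is the right multiple of [x]
   in both cases. *)
rewrite dual_orth_subcode -c_c2 => /orP[] cC.
  by rewrite (self_dual_dot cC c2C) scale0r addr0.
have := self_dual_dot cC c2C; rewrite dotDl (dotC x) c2x.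
by case: (F2P (dot c c2)) => [/eqP|] // _; rewrite scale1r.
Qed.

(** Rank and nullity of the map from [(a, b, c)] to [c + (a + b) x]: it sends [D] onto [C], with a
    kernel of dimension 1. *)
Lemma dim_ext : \dim D = (\dim C).+1.
Proof.
pose H : 'M_(1 + (1 + n), n) := col_mx x (col_mx x 1%:M).
pose f := linfun (mulmxr (m := 1) H).
have fE a b c : f (prefix2 a b c) = c + (a + b) *: x.
  by rewrite lfunE /= mul_prefix2.
have fD : (f @: D)%VS = C.
  apply/vspaceP => c; apply/memv_imgP/idP => [[v vD ->]|cC].
    have [a [b [c' ev]]] := prefix2P v; move: vD.
    by rewrite ev DS specS fE => /andP[].
  exists (prefix2 (dot c x) (dot c x) c); last first.
    by rewrite fE F2_addxx scale0r addr0.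
  by rewrite DS specS F2_addxx scale0r mulr0 !addr0 cC eqxx.
(* The kernel word with [a + b = 1]: then [c = x], and [dot x x = 1] forces [a = 1 + t]. *)
pose w := prefix2 (1 + t) t x.
have w0 : w != 0.
  apply/eqP; rewrite -prefix2_eq0 => /prefix2_inj[_ _ x0].
  by move: odd_notin; rewrite x0 mem0v.
have kerD : (D :&: lker f)%VS = <[w]>%VS.
  apply/vspaceP => v; have [a [b [c ->]]] := prefix2P v.
  rewrite memv_cap DS specS memv_ker fE; apply/idP/vlineP.
    case/andP=> /andP[_ /eqP cx] /eqP c0.
    have ec : c = (a + b) *: x.
      by rewrite -[LHS]addr0 -(F2_addvv ((a + b) *: x)) addrA c0 add0r.
    exists (a + b); rewrite prefix2Z -ec.
    move: cx; rewrite ec dotZl dot_self_odd mulr1 => /eqP cx.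
    congr prefix2; apply/eqP; move: cx.
      by case: (F2P a); case: (F2P b); case: (F2P t).
    by case: (F2P a); case: (F2P b); case: (F2P t).
  case=> k; rewrite prefix2Z => /prefix2_inj[-> -> ->].
  rewrite -mulrDr -addrA F2_addxx addr0 mulr1 F2_addvv mem0v eqxx andbT /=.
  by rewrite dotZl dot_self_odd; case: (F2P k); case: (F2P t).
by rewrite -(limg_ker_dim f D) fD kerD dim_vline w0.
Qed.

(** * Weights and shadow of C(x) *)

Hypotheses (evC : doubly_even C) (wt_x : wt x = 1 %[mod 4]).

Lemma ext_x_mem : prefix2 (1 + t) t x \in D.
Proof.
rewrite DS specS -addrA F2_addxx addr0 scale1r mulr1 F2_addvv mem0v.
by rewrite -addrA F2_addxx addr0 dot_self_odd eqxx.
Qed.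

Lemma wt_ext_x : wt (prefix2 (1 + t) t x) = (wt x).+1.
Proof. by rewrite wt_prefix2; case: (F2P t). Qed.

Lemma ext_singly_even : singly_even D.
Proof.
exists (prefix2 (1 + t) t x); first exact: ext_x_mem.
by rewrite wt_ext_x -addn1 -modnDml wt_x.
Qed.

(** A word with [a = b] ends in a word of [C]; any other has one nonzero prefix bit and ends in a
    word of [x + C]. The word built on [x] itself attains the bound. *)
Lemma ext_min_weight d :
    (wt x).+1 = d -> (forall c, c \in C -> c != 0 -> (d <= wt c)%N) ->
    (forall c, c \in C -> (d <= (wt (x + c)).+1)%N) ->
  min_weight (mem D) d.
Proof.
move=> xd Cd xCd; split.
  exists (prefix2 (1 + t) t x); split; first exact: ext_x_mem.
    by rewrite -wt_gt0 wt_ext_x.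
  by rewrite wt_ext_x.
move=> v vD; have {vD}: v \in D by [].
have [a [b [c ->]]] := prefix2P v; rewrite DS specS wt_prefix2.
case: (F2_cases (a + b)) => ab; rewrite ab.
  rewrite scale0r mulr0 !addr0 => /andP[cC /eqP cx].
  have [c0|c0 _] := eqVneq c 0; last first.
    by rewrite addnA (leq_trans (Cd c cC c0)) ?leq_addl.
  (* With [c = 0] the condition on [dot c x] gives [a = 0], so the whole word is zero. *)
  move: cx ab; rewrite c0 dot0l => <-; rewrite add0r => ->.
  by rewrite prefix2_eq0 eqxx.
rewrite scale1r => /andP[/xCd]; rewrite addrCA F2_addvv addr0 => le_d _ _.
by move: ab le_d => /eqP; case: (F2P a); case: (F2P b).
Qed.

(** The product of the unit vector [(1 + t, t, 0)] with a word of [D] is [dot c x]; where this is 1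
    the weight is 2 modulo 4, so the word is outside the doubly even subcode. *)
Lemma ext_shadow : min_weight (mem (shadow D)) 1.
Proof.
split; last by move=> c _; rewrite wt_gt0.
pose s : 'rV['F_2]_n.+2 := prefix2 (1 + t) t 0.
have wt_s : wt s = 1%N by rewrite wt_prefix2 wt0; case: (F2P t).
exists s; split=> //; last by rewrite -wt_gt0 wt_s.
suff: s \in shadow D by [].
rewrite in_setD inE; apply/andP; split.
  have [c2 c2C c2x] := exists_nonorth.
  apply/negP; rewrite ext_self_dual => /dual_vspaceP/(_ (prefix2 1 1 c2)).
  rewrite DS specS F2_addxx scale0r mulr0 !addr0 c2C c2x eqxx => /(_ isT)/eqP.
  by rewrite dot_prefix2 dot0l; case: (F2P t).
apply/dualP => v; rewrite inE; have [a [b [c ->]]] := prefix2P v.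
rewrite DS specS wt_prefix2 => /andP[/andP[cC /eqP cx] wt4].
rewrite dot_prefix2 dot0l addr0.
have ->: (1 + t) * a + t * b = dot c x.
  by rewrite cx; apply/eqP; case: (F2P t); case: (F2P a); case: (F2P b).
case: (F2_cases (dot c x)) => // cx1; move: cC cx wt4; rewrite cx1.
case: (F2_cases (a + b)) => ab; rewrite ab ?scale0r ?scale1r.
  rewrite mulr0 !addr0 => cC a1.
  have b1 : b = 1 by apply/eqP; move: ab => /eqP; rewrite -a1; case: (F2P b).
  by rewrite -a1 b1 /= !addnA dvdn_addl // evC.
move=> cxC _.
(* [c] is the sum of [c + x], which is in [C], and [x]; these are orthogonal, so their weights add
   modulo 4. *)
have wtc : wt c = 1 %[mod 4].
  rewrite -[c]addr0 -(F2_addvv x) addrA wtD_mod4; last first.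
    by rewrite dotDl cx1 dot_self_odd F2_addxx.
  by rewrite -modnDml (eqP (evC cxC)).
have -> : ((a != 0%R) + ((b != 0%R) + wt c) = (wt c).+1)%N.
  by move/eqP: ab; case: (F2P a); case: (F2P b).
by rewrite /dvdn -addn1 -modnDml wtc.
Qed.

End Spec.

End Extension.

(** * Self-dual codes generated by [I | A] *)

Lemma code_of_gen_limg k n (G : 'M['F_2]_(k, n)) :
  code_of_gen G = limg (linfun (mulmxr (m := 1) G)).
Proof.
apply/eqP; rewrite eqEsubv; apply/andP; split.
  apply/span_subvP => v /mapP[i _ ->].
  by rewrite rowE -[_ *m G]/(mulmxr G _) -lfunE memv_img ?memvf.
apply/subvP => v /memv_imgP[y _ ->]; rewrite lfunE /= mulmx_sum_row.
apply: rpred_sum => i _; apply: rpredZ; apply: memv_span.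
by apply/mapP; exists i; rewrite ?mem_enum.
Qed.

Lemma code_of_genP k n (G : 'M['F_2]_(k, n)) v :
  reflect (exists y, v = y *m G) (v \in code_of_gen G).
Proof.
rewrite code_of_gen_limg; apply: (iffP memv_imgP) => [[y _ ->]|[y ->]].
  by exists y; rewrite lfunE.
by exists y; rewrite ?memvf // lfunE.
Qed.

Lemma wt_row_mx m n (u : 'rV['F_2]_m) (v : 'rV['F_2]_n) :
  wt (row_mx u v) = (wt u + wt v)%N.
Proof.
rewrite !wtE big_split_ord; congr (_ + _)%N; apply: eq_bigr => i _.
  by rewrite row_mxEl.
by rewrite row_mxEr.
Qed.

Lemma dot_row_mx m n (u u' : 'rV['F_2]_m) (v v' : 'rV['F_2]_n) :
  dot (row_mx u v) (row_mx u' v') = dot u u' + dot v v'.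
Proof. by rewrite !dot_mx tr_row_mx mul_row_col mxE. Qed.

Section SystematicCode.
Variables (k : nat) (A : 'M['F_2]_k).
Hypothesis orthA : A *m A^T = 1%:M.
Local Notation C := (code_of_gen (row_mx 1%:M A)).

Lemma systematicP v : reflect (exists y, v = row_mx y (y *m A)) (v \in C).
Proof.
apply: (iffP (code_of_genP _ _)) => -[y ->]; exists y;
  by rewrite mul_mx_row mulmx1.
Qed.

Lemma systematic_dim : \dim C = k.
Proof.
rewrite code_of_gen_limg limg_dim_eq ?dimvf /=; first by rewrite /dim /= mul1n.
apply/eqP; rewrite -subv0; apply/subvP => y; rewrite memv_cap memv_ker lfunE /=.
rewrite mul_mx_row mulmx1 => /andP[_ /eqP]; rewrite -[0]row_mx0.
by case/eq_row_mx => -> _; rewrite memv0.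
Qed.

Lemma dot_mulmx (y z : 'rV['F_2]_k) : dot (y *m A) (z *m A) = dot y z.
Proof. by rewrite !dot_mx trmx_mul mulmxA -(mulmxA y) orthA mulmx1. Qed.

(** [A] preserves products, so the two halves of two codewords contribute equally and cancel.
    Conversely, orthogonality of [(u, w)] to the generators reads [u = w A^T], and [A^T A = 1] turns
    this into [w = u A]. *)
Lemma systematic_self_dual : self_dual C.
Proof.
move=> v; apply/systematicP/dual_vspaceP => [[y ->] c /systematicP[z ->]|h].
  by rewrite dot_row_mx dot_mulmx F2_addxx.
have [u [w ev]] : exists u w, v = row_mx u w.
  by exists (lsubmx v), (rsubmx v); rewrite hsubmxK.
have uE : u = w *m A^T.
  apply/rowP => i; pose e : 'rV['F_2]_k := delta_mx 0 i.
  have := h (row_mx e (e *m A)); rewrite ev dot_row_mx => h'.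
  have {h'}: dot u e + dot w (e *m A) = 0.
    by apply: h'; apply/systematicP; exists e.
  rewrite (_ : dot u e = u 0 i); last first.
    rewrite dot_mx mxE (bigD1 i) //= big1 => [|j /negPf ji].
      by rewrite !mxE !eqxx mulr1 addr0.
    by rewrite !mxE ji andbF mulr0.
  rewrite (_ : dot w (e *m A) = (w *m A^T) 0 i); last first.
    by rewrite -rowE mxE; apply: eq_bigr => j _; rewrite !mxE.
  move=> /eqP h0; apply/eqP; move: h0.
  by case: (F2P (u 0 i)); case: (F2P ((w *m A^T) 0 i)).
exists u; rewrite ev; congr row_mx.
by rewrite uE -mulmxA (mulmx1C orthA) mulmx1.
Qed.

(** In a self-orthogonal code weights add modulo 4, so the generators decide; the successor counts
    the one in the identity block. *)
Lemma systematic_doubly_even :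
  (forall i, 4 %| (wt (row i A)).+1)%N -> doubly_even C.
Proof.
move=> evA c /code_of_genP[y ->]; rewrite mulmx_sum_row.
(* Membership in [C] is carried along because adding weights modulo 4 needs orthogonal summands. *)
pose P (v : 'rV['F_2]_(k + k)) := (v \in C) && (4 %| wt v)%N.
suff: P (\sum_i y 0 i *: row i (row_mx 1%:M A)) by case/andP.
elim/big_ind: _ => [|u v /andP[uC u4] /andP[vC v4]|i _].
- by rewrite /P mem0v wt0.
- rewrite /P rpredD //= /dvdn wtD_mod4; last first.
    exact: self_dual_dot systematic_self_dual _ _ uC vC.
  by rewrite -modnDml (eqP u4).
have rE : row i (row_mx 1%:M A) = row_mx (delta_mx 0 i) (row i A).
  by rewrite row_row_mx row1.
case: (F2P (y 0 i)); rewrite /P ?scale0r ?scale1r ?mem0v ?wt0 // rE.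
apply/andP; split.
  by apply/systematicP; exists (delta_mx 0 i); rewrite -rowE.
rewrite wt_row_mx (_ : wt (delta_mx 0 i) = 1%N) ?add1n //.
rewrite wtE (bigD1 i) //= big1 => [|j /negPf ji]; first by rewrite !mxE !eqxx.
by rewrite !mxE ji andbF.
Qed.

End SystematicCode.

(** * Exhaustive search *)

(* Bit strings are positives closed by [xH], which carries no bit; this keeps
   the exhaustive search affordable by plain kernel reduction. *)
Fixpoint pxor (p q : positive) : positive :=
  match p, q with
  | xI p', xI q' | xO p', xO q' => xO (pxor p' q')
  | xI p', xO q' | xO p', xI q' => xI (pxor p' q')
  | _, _ => xH
  end.

Fixpoint pwt (p : positive) : nat :=
  match p with xI p' => (pwt p').+1 | xO p' => pwt p' | xH => 0 end.

(** Fuses [pxor] and [pwt]: no intermediate string is built, and the scan stops once the bound is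
    passed. *)
Fixpoint heavy (b : nat) (p q : positive) : bool :=
  match p, q with
  | xI p', xI q' | xO p', xO q' => heavy b p' q'
  | xI p', xO q' | xO p', xI q' => if b is b'.+1 then heavy b' p' q' else true
  | _, _ => false
  end.

Lemma heavyE b p q : heavy b p q = (b < pwt (pxor p q))%N.
Proof. by elim: p b q => [p IHp|p IHp|] [|b] [q|q|] //=; rewrite IHp. Qed.

(* Tests all sums of [p] with 1 to [w + 1] of the rows; the bound [b] on the
   weight drops by one with each further row, hence the form of [searchP]. *)
Fixpoint search (w b : nat) (p : positive) : seq positive -> bool :=
  match w, b with
  | w'.+1, b'.+1 => fix loop rs :=
      if rs is r :: rs' then
        if heavy b p r then
          if search w' b' (pxor p r) rs' then loop rs' else false
        else false
      else true
  | _, _ => fix loop rs :=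
      if rs is r :: rs' then if heavy b p r then loop rs' else false else true
  end.

Lemma search_cons w b p r rs : search w b p (r :: rs) ->
  [/\ (b < pwt (pxor p r))%N, search w b p rs
    & (0 < w)%N -> (0 < b)%N -> search w.-1 b.-1 (pxor p r) rs].
Proof.
by case: w => [|w]; case: b => [|b] /=; rewrite heavyE; case: ifP => // _;
  do ?case: ifP => //.
Qed.

(** Induction on the rows: skipping a row keeps [w] and [b], while taking one with others to follow
    lowers both, matching the drop in the number of rows still to be chosen. *)
Lemma searchP w b p rs m : search w b p rs -> size m = size rs ->
  (0 < count id m <= w.+1)%N ->
  (b.+1 < count id m + pwt (foldl pxor p (mask m rs)))%N.
Proof.
elim: rs w b p m => [|r rs IHrs] w b p [|[] m] //= /search_cons[hr hs hd] [sm].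
  case: (posnP (count id m)) => [m0 _|m_gt0 mw].
    by rewrite (size0nil (etrans (size_mask sm) m0)) m0.
  (* For [b = 0], two chosen rows exceed the bound by their number alone. *)
  case: b hr hs hd => [|b] hr hs hd; first by lia.
  have w_gt0 : (0 < w)%N by lia.
  have := IHrs _ _ _ m (hd w_gt0 isT) sm; rewrite m_gt0 /=.
  by move=> h; have := h ltac:(lia); lia.
by rewrite add0n => mw; apply: IHrs hs sm mw.
Qed.

Definition encode (s : bitseq) : positive :=
  foldr (fun b p => if b then xI p else xO p) xH s.

Definition bits n (v : 'rV['F_2]_n) : bitseq :=
  [seq v 0 i != 0 | i <- enum 'I_n].

Definition pbits n (v : 'rV['F_2]_n) := encode (bits v).

Lemma pbitsD n (u v : 'rV['F_2]_n) : pbits (u + v) = pxor (pbits u) (pbits v).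
Proof.
rewrite /pbits /bits; elim: (enum _) => //= i s ->.
by rewrite mxE; case: (F2P (u 0 i)); case: (F2P (v 0 i)).
Qed.

Lemma count_bits n (v : 'rV['F_2]_n) : count id (bits v) = wt v.
Proof. by rewrite wtE count_map -sum1_count big_mkcond big_enum. Qed.

Lemma pwt_pbits n (v : 'rV['F_2]_n) : pwt (pbits v) = wt v.
Proof.
rewrite -count_bits /pbits /encode.
by elim: (bits v) => [|[] s IHs] //=; rewrite IHs.
Qed.

Definition prows k n (M : 'M['F_2]_(k, n)) : seq positive :=
  [seq pbits (row i M) | i <- enum 'I_k].

Lemma pbits_mul k n (M : 'M['F_2]_(k, n)) u y :
  pbits (u + y *m M) = foldl pxor (pbits u) (mask (bits y) (prows M)).
Proof.
rewrite mulmx_sum_row -big_enum /bits /prows /=.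
elim: (enum 'I_k) u => [|i s IHs] u /=; first by rewrite big_nil addr0.
rewrite big_cons addrA IHs.
by case: (F2P (y 0 i)); rewrite ?scale0r ?addr0 //= scale1r pbitsD.
Qed.

Lemma search_wt k n (M : 'M['F_2]_(k, n)) w b u y :
  search w b (pbits u) (prows M) -> (0 < wt y <= w.+1)%N ->
  (b.+1 < wt y + wt (u + y *m M))%N.
Proof.
move=> sM yw; rewrite -[wt y]count_bits -pwt_pbits pbits_mul.
by apply: (searchP sM); rewrite ?size_map // count_bits.
Qed.

(** Entries come from a Boolean function, so that the checks can be evaluated on lists such as
    [bool_rows]. *)
Definition bool_mx k n (f : nat -> nat -> bool) : 'M['F_2]_(k, n) :=
  \matrix_(i, j) (f i j)%:R.

Definition bool_rows k n (f : nat -> nat -> bool) : seq positive :=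
  [seq encode [seq f i j | j <- iota 0 n] | i <- iota 0 k].

Lemma natb_neq0 (b : bool) : (b%:R != 0 :> 'F_2) = b.
Proof. by case: b. Qed.

Lemma prows_bool_mx k n f : prows (bool_mx k n f) = bool_rows k n f.
Proof.
rewrite /bool_rows -(val_enum_ord k) -map_comp; apply: eq_map => i /=.
congr encode; rewrite -(val_enum_ord n) -map_comp; apply: eq_map => j /=.
by rewrite !mxE natb_neq0.
Qed.

Lemma bool_mx_orth k f :
  all (fun i => all (fun j => odd (count (fun l => f i l && f j l) (iota 0 k))
                              == (i == j)) (iota 0 k)) (iota 0 k) ->
  bool_mx k k f *m (bool_mx k k f)^T = 1%:M.
Proof.
move=> /allP h; apply/matrixP => i j; rewrite [RHS]mxE.
have ii (l : 'I_k) : (l : nat) \in iota 0 k by rewrite mem_iota ltn_ord.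
have /allP/(_ _ (ii j))/eqP := h _ (ii i); rewrite -val_eqE => <-.
rewrite -natrF2 -sum1_count big_mkcond -(val_enum_ord k) big_map big_enum /=.
rewrite mxE natr_sum; apply: eq_bigr => l _; rewrite !mxE.
by case: (f i l); case: (f j l); rewrite ?mulr0 ?mulr1.
Qed.

(** * The code B80_4 *)

Definition R39_bits : bitseq :=
  map (fun m => m == 1%N)
    [:: 1; 1; 1; 1; 0; 0; 0; 0; 0; 1; 0; 0; 1; 0; 1; 1; 1; 1; 1; 0;
        1; 0; 1; 1; 1; 0; 1; 0; 0; 1; 1; 0; 1; 1; 0; 0; 0; 1; 1]%N.

(** The bordered circulant: adding [39 - i'] keeps the cyclic shift in the natural numbers, and the
    last branch puts 0 in the corner and 1 along the border. *)
Definition A40_bit (i j : nat) : bool :=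
  match i, j with
  | i'.+1, j'.+1 => nth false R39_bits ((j' + (39 - i')) %% 39)
  | _, _ => (0 < i + j)%N
  end.

Definition A40 : 'M['F_2]_40 := bool_mx 40 40 A40_bit.

Lemma gen_B80_4E : gen_B80_4 = row_mx 1%:M A40.
Proof.
apply: (congr1 (row_mx (1%:M : 'M_40))); apply/matrixP => i j; rewrite !mxE.
case: splitP => i' ii; rewrite mxE; case: splitP => j' jj; rewrite ?mxE ii jj.
- by rewrite (ord1 i') (ord1 j').
- by rewrite (ord1 i').
- by rewrite (ord1 j').
have -> : A40_bit (1 + i') (1 + j') = nth false R39_bits (j' - i')%R.
  by rewrite /A40_bit /= modnDmr.
move: (j' - i')%R => m; rewrite -(nth_map false 0 (fun b : bool => b%:R)) //.
Qed.

Lemma tr_A40 : A40^T = bool_mx 40 40 (fun i j => A40_bit j i).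
Proof. by apply/matrixP => i j; rewrite !mxE. Qed.

Lemma A40_orth : A40 *m A40^T = 1%:M.
Proof. by apply: bool_mx_orth; vm_compute. Qed.

Lemma A40_row_wt i : (4 %| (wt (row i A40)).+1)%N.
Proof.
have: all (fun p => 4 %| (pwt p).+1)%N (bool_rows 40 40 A40_bit) by vm_compute.
rewrite -prows_bool_mx all_map => /allP/(_ i)/=.
by rewrite mem_enum pwt_pbits; apply.
Qed.

Definition x40_bits : bitseq :=
  [seq j.+1 \in [:: 2; 5; 8; 11; 14; 17; 20; 23; 26; 29; 32; 35; 38]%N
  | j <- iota 0 40].

Definition x40 : 'rV['F_2]_40 := \row_j (nth false x40_bits j)%:R.

(** All support positions are at most 38, hence in the left half. *)
Lemma x80E : x80 = row_mx x40 0.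
Proof.
apply/rowP => j; rewrite !mxE; case: splitP => i ji; rewrite !mxE ji.
  by rewrite (nth_map 0%N) ?size_iota // nth_iota.
by case: i {ji} => i /= lti; do 40 (case: i lti => [|i] lti //).
Qed.

Lemma bits_x40 : bits x40 = x40_bits.
Proof.
rewrite /bits -[RHS](mkseq_nth false) /mkseq -(val_enum_ord (size _)) -map_comp.
by apply: eq_map => i /=; rewrite mxE natb_neq0.
Qed.

Lemma pbits_0 n : pbits (0 : 'rV['F_2]_n) = encode (nseq n false).
Proof.
rewrite /pbits; congr encode; rewrite -[in RHS](size_enum_ord n) /bits.
by elim: (enum _) => //= i s ->; rewrite mxE.
Qed.

Lemma pbits_x40A : pbits (x40 *m A40) = foldl pxor (encode (nseq 40 false))
  (mask x40_bits (bool_rows 40 40 A40_bit)).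
Proof. by rewrite -[_ *m _]add0r pbits_mul pbits_0 bits_x40 prows_bool_mx. Qed.

(** By [search_wt], the parameters 5 and 11 stand for at most 6 rows and total weight at least
    13. *)
Lemma search_A : search 5 11 (pbits (0 : 'rV['F_2]_40)) (prows A40).
Proof.
by rewrite pbits_0 prows_bool_mx; vm_cast_no_check (erefl true).
Qed.

Lemma search_AT : search 4 11 (pbits (0 : 'rV['F_2]_40)) (prows A40^T).
Proof.
by rewrite pbits_0 tr_A40 prows_bool_mx; vm_cast_no_check (erefl true).
Qed.

(** Covers the coset words [(z, x40 A + z A)]; 4 and 10 stand for at most 5 rows and total weight at
    least 12. *)
Lemma search_x40A : search 4 10 (pbits (x40 *m A40)) (prows A40).
Proof.
by rewrite pbits_x40A prows_bool_mx; vm_cast_no_check (erefl true).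
Qed.

(** Covers the coset words [(x40 + q A^T, q)] in the same range. *)
Lemma search_x40_AT : search 4 10 (pbits x40) (prows A40^T).
Proof.
by rewrite /pbits bits_x40 tr_A40 prows_bool_mx; vm_cast_no_check (erefl true).
Qed.

Local Notation C := (code_of_gen (row_mx 1%:M A40)).

(** Halves of weight at least 7 and 6 already give 13; otherwise one of the two searches applies. *)
Lemma B80_wt_ge c : c \in C -> c != 0 -> (13 <= wt c)%N.
Proof.
case/systematicP => y -> ; rewrite wt_row_mx => c0.
have [y6|y7] := leqP (wt y) 6.
  have := search_wt (y := y) search_A; rewrite add0r; apply.
  rewrite y6 andbT wt_gt0; apply: contraNneq c0 => ->.
  by rewrite mul0mx row_mx0.
have yE : y = y *m A40 *m A40^T by rewrite -mulmxA A40_orth mulmx1.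
have [yA5|yA6] := leqP (wt (y *m A40)) 5; last by lia.
rewrite addnC [in X in (_ + X)%N]yE.
have := search_wt (y := y *m A40) search_AT; rewrite add0r; apply.
rewrite yA5 andbT wt_gt0; apply: contraTneq y7 => yA0.
by rewrite yE yA0 mul0mx wt0.
Qed.

Lemma wt_x40 : wt x40 = 13%N.
Proof. by rewrite -count_bits bits_x40. Qed.

(** The halves are [z = x40 + y] and [q = y A]; weight at least 6 on both gives 12. The searches
    need a nonempty choice of rows, so [q = 0] and [z = 0] are treated apart. *)
Lemma x80_coset_wt_ge c : c \in C -> (12 <= wt (row_mx x40 0 + c))%N.
Proof.
case/systematicP => y ->; rewrite add_row_mx add0r wt_row_mx.
have [z5|z6] := leqP (wt (x40 + y)) 5; last first.
  have [q5|q6] := leqP (wt (y *m A40)) 5; last by lia.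
  have yE : y = y *m A40 *m A40^T by rewrite -mulmxA A40_orth mulmx1.
  have [q0|q_gt0] := posnP (wt (y *m A40)).
    move/eqP: q0; rewrite wt_eq0 => /eqP q0.
    by rewrite yE q0 mul0mx addr0 wt_x40.
  rewrite addnC [in X in (_ + X)%N]yE.
  by apply: (search_wt search_x40_AT); rewrite q_gt0.
have {2}-> : y = x40 + (x40 + y) by rewrite addrA F2_addvv add0r.
rewrite mulmxDl; have [z0|z_gt0] := posnP (wt (x40 + y)).
  move/eqP: (z0); rewrite wt_eq0 => /eqP ->; rewrite mul0mx addr0.
  (* Only the weight of [x40 A] remains, and it is evaluated. *)
  by rewrite wt0 -pwt_pbits pbits_x40A.
by apply: (search_wt search_x40A); rewrite z_gt0.
Qed.

Theorem proposition7 :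
  (exists S : {set 'rV['F_2]_82}, is_code_ext B80_4 x80 S) /\
  (forall S : {set 'rV['F_2]_82}, is_code_ext B80_4 x80 S ->
     exists2 C82 : {vspace 'rV['F_2]_82}, C82 =i S &
       [/\ singly_even C82, self_dual C82, code_params C82 41 14 &
           minimal_shadow C82]).
Proof.
have BE : B80_4 = C by rewrite /B80_4 gen_B80_4E.
have selfC : self_dual B80_4.
  by rewrite BE; apply: systematic_self_dual A40_orth.
have evC : doubly_even B80_4.
  by rewrite BE; apply: systematic_doubly_even A40_orth A40_row_wt.
have dimC : \dim B80_4 = 40%N by rewrite BE; exact (systematic_dim A40).
have minC c : c \in B80_4 -> c != 0 -> (13 <= wt c)%N.
  by rewrite BE; apply: B80_wt_ge.
have minxC c : c \in B80_4 -> (12 <= wt (x80 + c)%R)%N.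
  by rewrite BE x80E; apply: x80_coset_wt_ge.
have wx : wt x80 = 13%N.
  have := wt_row_mx x40 (0 : 'rV_40).
  by rewrite wt0 wt_x40 addn0 -[row_mx _ _]x80E.
have x_odd : odd (wt x80) by rewrite wx.
split; first exact: code_ext_exists selfC x_odd evC.
move=> S /(code_ext_spec selfC x_odd)[t specS].
have DS := ext_span specS.
exists <<enum S>>%VS => //.
have min14C c : c \in B80_4 -> c != 0 -> (14 <= wt c)%N.
  (* A multiple of 4 that is at least 13 is at least 16. *)
  by move=> cC c0; have := minC c cC c0; have := evC c cC; lia.
have min13xC c : c \in B80_4 -> (14 <= (wt (x80 + c)%R).+1)%N.
  (* As [wt x80] is odd and [wt c] even, [x80 + c] has odd weight, which improves 12 to 13. *)
  move=> cC; have := minxC c cC; have := evC c cC; have := wtD x80 c.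
  by rewrite wx; lia.
split.
- by apply: (ext_singly_even x_odd specS DS); rewrite wx.
- exact: (ext_self_dual selfC x_odd specS DS).
- split; first by rewrite (dim_ext selfC x_odd specS DS) dimC.
  by apply: (ext_min_weight x_odd specS DS) => //; rewrite wx.
(* Since 82 is 2 modulo 8, the required minimum weight of the shadow is 1. *)
- by apply: (ext_shadow selfC x_odd specS DS) => //; rewrite wx.
Qed.
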